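(* If $X$ is a Banach space, then the projective tensor product $c_0\widehat{\otimes}_\pi X$ is locally almost square. Moreover, $c_0\widehat{\otimes}_\pi X$ has the diameter two property.
   Context: All Banach spaces are real and non-zero. $B_X$ and $S_X$ denote the closed unit ball and the unit sphere of $X$. The projective tensor product $X\widehat{\otimes}_\pi Y$ is the completion of $X\otimes Y$ under the norm $\|u\|:=\inf\{\sum_{i=1}^n\|x_i\|\|y_i\| : u=\sum_{i=1}^n x_i\otimes y_i\}$. A Banach space $X$ is locally almost square (LASQ) if for every $x\in S_X$ there exists a sequence $\{y_n\}$ in $B_X$ such that $\|x\pm y_n\|\to 1$ and $\|y_n\|\to 1$. $X$ has the diameter two property (D2P) if each non-empty relatively weakly open subset of $B_X$ has diameter two. *)

(* Defs.v *)
From HB Require Import structures.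
From mathcomp Require Import all_boot all_order all_algebra sesquilinear.
From mathcomp Require Import all_classical all_reals all_analysis.

Set Implicit Arguments.
Unset Strict Implicit.
Unset Printing Implicit Defensive.

Import Order.TTheory GRing.Theory Num.Theory.
Import numFieldNormedType.Exports.

Local Open Scope classical_set_scope.
Local Open Scope ring_scope.
Local Open Scope quotient_scope.

Section c0.
Variable R : realType.

Definition c0_pred : {pred nat -> R^o} := mem [set x | x @ \oo --> (0 : R)].

Lemma c0_submod_closed : submod_closed c0_pred.
Proof.
split; first by rewrite inE /=; exact: cvg_cst.
move=> a x y /[!inE] /= hx hy.
have -> : (0 : R) = a *: (0 : R^o) + 0 by rewrite scaler0 addr0.
by apply: cvgD => //; apply: cvgZl_tmp.
Qed.

HB.instance Definition _ :=
  GRing.isSubmodClosed.Build R (nat -> R^o) c0_pred c0_submod_closed.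

Record c0 := C0 { c0_val :> nat -> R^o; c0_valP : c0_val \in c0_pred }.

HB.instance Definition _ := [isSub for c0_val].
HB.instance Definition _ := [Choice of c0 by <:].
HB.instance Definition _ := [SubChoice_isSubLmodule of c0 by <:].

Definition c0_norm (x : c0) : R := sup [set `|x n| | n in setT].

Lemma c0_cvg (x : c0) : (x : nat -> R) @ \oo --> (0 : R).
Proof. by have := c0_valP x; rewrite inE. Qed.

Lemma c0_has_sup (x : c0) : has_sup [set `|x n| | n in setT].
Proof.
split; first by exists `|x 0%N|, 0%N.
have /cvg_seq_bounded : cvgn (x : nat -> R) by apply/cvg_ex; exists 0; exact: c0_cvg.
by move=> [M [_ hM]]; exists (M + 1) => _ [n _ <-]; apply: hM => //; rewrite ltrDl.
Qed.

Lemma c0_norm_ge (x : c0) n : `|x n| <= c0_norm x.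
Proof. by apply: sup_upper_bound; [exact: c0_has_sup | exists n]. Qed.

Lemma c0_norm_le (x : c0) (r : R) : (forall n, `|x n| <= r) -> c0_norm x <= r.
Proof.
move=> h; apply: ge_sup; first by exists `|x 0%N|, 0%N.
by move=> _ [n _ <-].
Qed.

Lemma c0_normD (x y : c0) : c0_norm (x + y) <= c0_norm x + c0_norm y.
Proof.
apply: c0_norm_le => n; apply: (le_trans (ler_normD (x n) (y n))).
by apply: lerD; exact: c0_norm_ge.
Qed.

Lemma c0_normZ (a : R) (x : c0) : c0_norm (a *: x) = `|a| * c0_norm x.
Proof.
have le_normZ b z : c0_norm (b *: z) <= `|b| * c0_norm z.
  apply: c0_norm_le => n; rewrite (_ : (b *: z) n = b * z n)// normrM.
  by rewrite ler_wpM2l// c0_norm_ge.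
apply/eqP; rewrite eq_le le_normZ /=.
have [->|a0] := eqVneq a 0.
  by rewrite normr0 mul0r (le_trans _ (c0_norm_ge _ 0)).
rewrite -ler_pdivlMl ?normr_gt0// -normfV.
by rewrite -[in leLHS](scalerK a0 x); exact: le_normZ.
Qed.

Lemma c0_norm_eq0 (x : c0) : c0_norm x = 0 -> x = 0.
Proof.
move=> x0; apply/val_inj/funext => n /=; apply/eqP.
by rewrite -normr_le0 -x0 c0_norm_ge.
Qed.

HB.instance Definition _ :=
  Lmodule_isNormed.Build R c0 c0_normD c0_normZ c0_norm_eq0.

End c0.

Record seminorm (R : realType) (V : lmodType R) (p : V -> R) : Prop :=
  Seminorm {
    seminormD : forall u v, p (u + v) <= p u + p v;
    seminormZ : forall a v, p (a *: v) = `|a| * p v }.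

Section seminorm_theory.
Variables (R : realType) (V : lmodType R) (p : V -> R) (hp : seminorm p).

Lemma seminorm0 : p 0 = 0.
Proof. by rewrite -(scale0r 0) (seminormZ hp) normr0 mul0r. Qed.

Lemma seminormN v : p (- v) = p v.
Proof. by rewrite -scaleN1r (seminormZ hp) normrN1 mul1r. Qed.

Lemma seminormBC u v : p (u - v) = p (v - u).
Proof. by rewrite -seminormN opprB. Qed.

Lemma seminorm_ge0 v : 0 <= p v.
Proof.
have := seminormD hp v (- v); rewrite subrr seminorm0 seminormN.
by rewrite -mulr2n pmulrn_lge0.
Qed.

Lemma seminorm_triangle w u v : p (u - v) <= p (u - w) + p (w - v).
Proof. by rewrite -{1}(subrK w u) -addrA; exact: seminormD. Qed.

Lemma seminorm_dist u v : `|p u - p v| <= p (u - v).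
Proof.
rewrite ler_norml; apply/andP; split; last first.
  by rewrite lerBlDr -{1}(subrK v u); exact: seminormD.
rewrite lerNl opprB lerBlDr seminormBC -{1}(subrK u v).
exact: seminormD.
Qed.

End seminorm_theory.

Section cauchy_sequences.
Variables (R : realType) (V : lmodType R) (p : V -> R) (hp : seminorm p).

Definition pcauchy (u : nat -> V) : Prop :=
  forall e : R, 0 < e -> exists N, forall m n,
    (N <= m)%N -> (N <= n)%N -> p (u m - u n) < e.

Definition cauchy_seq_pred of seminorm p : {pred nat -> V} := mem [set u | pcauchy u].

Lemma cauchy_seq_submod_closed : submod_closed (cauchy_seq_pred hp).
Proof.
split.
  rewrite inE => e e0; exists 0%N => m n _ _.
  by rewrite (_ : _ - _ = 0) ?(seminorm0 hp)// subrr.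
move=> a u v /[!inE] hu hv e e0.
have a1 : 0 < `|a| + 1 by rewrite ltr_wpDl.
have [N hN] := hu (e / 2 / (`|a| + 1)) ltac:(by rewrite !divr_gt0).
have [M hM] := hv (e / 2) ltac:(by rewrite divr_gt0).
exists (maxn N M) => m n; rewrite !geq_max => /andP[Nm Mm] /andP[Nn Mn].
rewrite (_ : _ - _ = a *: (u m - u n) + (v m - v n)); last first.
  by rewrite scalerBr addrACA -opprD.
apply: (le_lt_trans (seminormD hp _ _)); rewrite (splitr e).
apply: ler_ltD; last exact: hM.
rewrite (seminormZ hp) (le_trans (ler_wpM2l _ (ltW (hN m n _ _))))//.
by rewrite mulrCA ger_pMr ?divr_gt0// ler_pdivrMr// mul1r lerDl.
Qed.

HB.instance Definition _ := GRing.isSubmodClosed.Build R (nat -> V)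
  (cauchy_seq_pred hp) cauchy_seq_submod_closed.

Record cauchy_seqs := CauchySeq {
  cauchy_seq_val :> nat -> V;
  cauchy_seq_valP : cauchy_seq_val \in cauchy_seq_pred hp }.

HB.instance Definition _ := [isSub for cauchy_seq_val].
HB.instance Definition _ := [Choice of cauchy_seqs by <:].
HB.instance Definition _ := [SubChoice_isSubLmodule of cauchy_seqs by <:].

Lemma cauchy_seqP (u : cauchy_seqs) : pcauchy u.
Proof. by have := cauchy_seq_valP u; rewrite inE. Qed.

Definition null_seq (u : nat -> V) : Prop :=
  (p \o u : nat -> R) @ \oo --> (0 : R).

Lemma null_seq0 : null_seq (0 : cauchy_seqs).
Proof.
rewrite /null_seq (_ : _ \o _ = cst 0); first exact: cvg_cst.
by apply/funext => n /=; rewrite (seminorm0 hp).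
Qed.

Lemma null_seqD (u v : cauchy_seqs) :
  null_seq u -> null_seq v -> null_seq (u + v).
Proof.
move=> hu hv; apply: (@squeeze_cvgr _ _ _ _ (cst 0)
  ((p \o u : nat -> R) \+ (p \o v : nat -> R))).
- by apply: nearW => n /=; rewrite seminorm_ge0//; exact: (seminormD hp).
- exact: cvg_cst.
- by rewrite -[X in _ --> X]addr0; exact: cvgD.
Qed.

Lemma null_seqZ a (u : cauchy_seqs) : null_seq u -> null_seq (a *: u).
Proof.
move=> hu; rewrite /null_seq.
rewrite (_ : _ \o _ = fun n => `|a| * p (u n)); last first.
  by apply/funext => n /=; exact: (seminormZ hp).
by rewrite -[X in _ --> X](mulr0 `|a|); exact: cvgMl_tmp.
Qed.

Definition cauchy_eq (u v : cauchy_seqs) : bool := `[< null_seq (u - v) >].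

Lemma cauchy_eq_refl : reflexive cauchy_eq.
Proof. by move=> u; apply/asboolP; rewrite subrr; exact: null_seq0. Qed.

Lemma cauchy_eq_sym : symmetric cauchy_eq.
Proof.
by move=> u v; apply/asboolP/asboolP => /(null_seqZ (-1));
  rewrite scaleN1r opprB.
Qed.

Lemma cauchy_eq_trans : transitive cauchy_eq.
Proof.
move=> v u w /asboolP uv /asboolP vw; apply/asboolP.
by rewrite -(subrK v u) -addrA; exact: null_seqD.
Qed.

Canonical cauchy_eq_equiv :=
  EquivRel cauchy_eq cauchy_eq_refl cauchy_eq_sym cauchy_eq_trans.

(* Cauchy sequences modulo null sequences.  If [p] is only a seminorm, this is
   the completion of the normed space obtained by separating [(V, p)]. *)
Definition completion : Type := {eq_quot cauchy_eq}.

HB.instance Definition _ := Choice.on completion.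
HB.instance Definition _ := EqQuotient.on completion.

Local Notation class u := (\pi_completion (u : cauchy_seqs)).

Lemma completion_eqP (u v : cauchy_seqs) : class u = class v <-> null_seq (u - v).
Proof.
split=> [/eqmodP/asboolP //|h].
by apply/eqmodP/asboolP.
Qed.

Definition completion_add (x y : completion) : completion :=
  class (repr x + repr y).
Definition completion_opp (x : completion) : completion := class (- repr x).
Definition completion_scale (a : R) (x : completion) : completion :=
  class (a *: repr x).

Lemma null_seq_repr (u : cauchy_seqs) : null_seq (repr (class u) - u).
Proof. by apply/completion_eqP; rewrite reprK. Qed.

Lemma class_add u v : completion_add (class u) (class v) = class (u + v).
Proof.
apply/completion_eqP; rewrite opprD addrACA.
by apply: null_seqD; exact: null_seq_repr.
Qed.

Lemma class_opp u : completion_opp (class u) = class (- u).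
Proof.
apply/completion_eqP; rewrite -opprD -scaleN1r.
by apply: null_seqZ; exact: null_seq_repr.
Qed.

Lemma class_scale a u : completion_scale a (class u) = class (a *: u).
Proof.
apply/completion_eqP; rewrite -scalerBr.
by apply: null_seqZ; exact: null_seq_repr.
Qed.

Lemma completion_addA : associative completion_add.
Proof.
move=> x y z; elim/quotW: x => u; elim/quotW: y => v; elim/quotW: z => w.
by rewrite (class_add v) (class_add u v) (class_add u) (class_add (u + v)) addrA.
Qed.

Lemma completion_addC : commutative completion_add.
Proof. by move=> x y; rewrite /completion_add addrC. Qed.

Lemma completion_add0 : left_id (class 0) completion_add.
Proof. by elim/quotW => u; rewrite (class_add 0 u) add0r. Qed.

Lemma completion_addN : left_inverse (class 0) completion_opp completion_add.
Proof. by elim/quotW => u; rewrite (class_opp u) (class_add (- u) u) addNr. Qed.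

HB.instance Definition _ := GRing.isZmodule.Build completion
  completion_addA completion_addC completion_add0 completion_addN.

Lemma classD u v : class (u + v) = class u + class v.
Proof. exact/esym/class_add. Qed.

Lemma completion_scaleA a b x :
  completion_scale a (completion_scale b x) = completion_scale (a * b) x.
Proof. by elim/quotW: x => u; rewrite (class_scale b u) (class_scale a (b *: u)) scalerA (class_scale (a * b) u). Qed.

Lemma completion_scale1 : left_id 1 completion_scale.
Proof. by elim/quotW => u; rewrite (class_scale 1 u) scale1r. Qed.

Lemma completion_scaleDr : right_distributive completion_scale +%R.
Proof.
move=> a; elim/quotW => u; elim/quotW => v.
by rewrite -classD (class_scale a (u + v)) scalerDr classD (class_scale a u)
  (class_scale a v).
Qed.

Lemma completion_scaleDl x : {morph completion_scale^~ x : a b / a + b}.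
Proof. move=> a b; elim/quotW: x => u.
by rewrite (class_scale (a + b) u) scalerDl classD (class_scale a u)
  (class_scale b u). Qed.

HB.instance Definition _ := GRing.Zmodule_isLmodule.Build R completion
  completion_scaleA completion_scale1 completion_scaleDr completion_scaleDl.

Lemma classZ a u : class (a *: u) = a *: class u.
Proof. exact/esym/class_scale. Qed.

Lemma classN u : class (- u) = - class u.
Proof. by rewrite -scaleN1r classZ scaleN1r. Qed.

Definition completion_norm (x : completion) : R := limn (p \o repr x).

Lemma cauchy_seq_norm_cvg (u : cauchy_seqs) : cvgn (p \o u : nat -> R).
Proof.
apply/cauchy_cvgP/cauchy_exP => e e0.
have [N hN] := cauchy_seqP u e0.
exists (p (u N)); exists N => // n /= Nn.
by rewrite /ball /= (le_lt_trans (seminorm_dist hp _ _))// hN//=.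
Qed.
Arguments cauchy_seq_norm_cvg : clear implicits.

Lemma class_norm_cvg (u : cauchy_seqs) :
  (p \o u : nat -> R) @ \oo --> completion_norm (class u).
Proof.
set v := repr (class u).
have vcvg := cauchy_seq_norm_cvg v.
have uv : (p \o u : nat -> R) \- (p \o v : nat -> R) @ \oo --> (0 : R).
  apply/norm_cvg0P; apply: (@squeeze_cvgr _ _ _ _ (cst 0) (p \o (v - u) : nat -> R)).
  - apply: nearW => n; rewrite normr_ge0 /=.
    by rewrite distrC; exact: seminorm_dist.
  - exact: cvg_cst.
  - exact: null_seq_repr.
rewrite -[X in X @ _](_ : (p \o v) \+ ((p \o u) \- (p \o v)) = _); last first.
  by apply/funext => n /=; rewrite addrC subrK.
by rewrite -[X in _ --> X]addr0; exact: cvgD.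
Qed.
Arguments class_norm_cvg : clear implicits.

Lemma completion_normD x y :
  completion_norm (x + y) <= completion_norm x + completion_norm y.
Proof.
rewrite -[x]reprK -[y]reprK -classD.
apply: (ler_cvg_to (class_norm_cvg _) (cvgD (class_norm_cvg _) (class_norm_cvg _))).
by apply: nearW => n; exact: (seminormD hp).
Qed.

Lemma completion_normZ a x :
  completion_norm (a *: x) = `|a| * completion_norm x.
Proof.
rewrite -[x]reprK -classZ.
apply: (cvg_unique (@Rhausdorff R) (class_norm_cvg _)).
rewrite (_ : _ \o _ = fun n => `|a| * p (repr x n)); last first.
  by apply/funext => n; exact: (seminormZ hp).
exact: cvgMl_tmp (class_norm_cvg _).
Qed.

Lemma completion_norm_eq0 x : completion_norm x = 0 -> x = 0.
Proof.
rewrite -[x]reprK => x0; apply/completion_eqP; rewrite subr0 /null_seq -x0.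
exact: class_norm_cvg.
Qed.

HB.instance Definition _ := Lmodule_isNormed.Build R completion
  completion_normD completion_normZ completion_norm_eq0.

Lemma completion_norm_class (u : cauchy_seqs) :
  (p \o u : nat -> R) @ \oo --> `|class u|.
Proof. exact: class_norm_cvg. Qed.
Arguments completion_norm_class : clear implicits.

Lemma cst_cauchy (v : V) : (fun=> v) \in cauchy_seq_pred hp.
Proof.
by rewrite inE => e e0; exists 0%N => m n _ _; rewrite subrr (seminorm0 hp).
Qed.

Definition to_completion (v : V) : completion := class (CauchySeq (cst_cauchy v)).

Lemma to_completion_is_linear : linear to_completion.
Proof.
move=> a u v; rewrite /to_completion -classZ -classD; congr (\pi _).
exact: val_inj.
Qed.

HB.instance Definition _ :=
  GRing.isLinear.Build R V completion _ to_completion to_completion_is_linear.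

Lemma to_completion_norm v : `|to_completion v| = p v.
Proof.
apply: (cvg_unique (@Rhausdorff R)
  (completion_norm_class (CauchySeq (cst_cauchy v)))).
rewrite (_ : _ \o _ = cst (p v)); first exact: cvg_cst.
exact: funext.
Qed.

Lemma to_completion_near (u : cauchy_seqs) (e : R) n :
  (exists N, forall m, (N <= m)%N -> p (u m - u n) <= e) ->
  `|class u - to_completion (u n)| <= e.
Proof.
move=> [N hN]; rewrite -classN -classD.
apply: (ler_cvg_to (completion_norm_class _) (cvg_cst e)).
by exists N => // m /= Nm; exact: hN.
Qed.

Lemma to_completion_dense (x : completion) (e : R) :
  0 < e -> exists v, `|x - to_completion v| < e.
Proof.
move=> e0; rewrite -[x]reprK.
have e20 : 0 < e / 2 by rewrite divr_gt0.
have [N hN] := cauchy_seqP (repr x) e20.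
exists (repr x N); apply: (@le_lt_trans _ _ (e / 2)).
  by apply: to_completion_near; exists N => m Nm; exact/ltW/hN.
by rewrite ltr_pdivrMr// ltr_pMr// ltr1n.
Qed.

Lemma completion_complete (F : set_system completion) :
  ProperFilter F -> cauchy F -> cvg F.
Proof.
move=> FF /cauchyP Fc.
have r0 n : 0 < n.+1%:R^-1 :> R by rewrite invr_gt0 ltr0n.
have /choice[w hw] n : exists v, F [set x | `|to_completion v - x| < n.+1%:R^-1].
  have r20 : 0 < n.+1%:R^-1 / 2 :> R by rewrite divr_gt0.
  have [x Fx] := Fc _ r20; have [v xv] := to_completion_dense x r20.
  exists v; apply: filterS Fx => y; rewrite -ball_normE /= => xy.
  rewrite (le_lt_trans (ler_distD x _ _))//.
  by rewrite (splitr n.+1%:R^-1) ltrD// distrC.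
have wd m n : p (w m - w n) <= m.+1%:R^-1 + n.+1%:R^-1.
  have [x [/= xm xn]] := filter_ex (filterI (hw m) (hw n)).
  rewrite -to_completion_norm [to_completion _]linearB.
  by rewrite (le_trans (ler_distD x _ _))// lerD ?ltW// distrC.
have small (e : R) : 0 < e -> exists N, forall n, (N <= n)%N -> n.+1%:R^-1 < e.
  move=> e0; have [N _ hN] := near_infty_natSinv_lt (PosNum e0).
  by exists N => n Nn; exact: hN.
have wc : w \in cauchy_seq_pred hp.
  rewrite inE => e e0; have [N hN] := small (e / 2) ltac:(by rewrite divr_gt0).
  exists N => m n Nm Nn; rewrite (le_lt_trans (wd m n))// (splitr e).
  by rewrite ltrD// hN.
apply/cvg_ex; exists (class (CauchySeq wc)); apply/cvgrPdist_lt => e e0.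
have e30 : 0 < e / 2 / 2 by rewrite !divr_gt0.
have [N hN] := small _ e30.
have near_w : `|class (CauchySeq wc) - to_completion (w N)| <= e / 2.
  apply: (to_completion_near (u := CauchySeq wc)); exists N => m Nm /=.
  by rewrite (le_trans (wd _ _))// (splitr (e / 2)) lerD// ltW// hN.
apply: filterS (hw N) => x /= wx.
rewrite (le_lt_trans (ler_distD (to_completion (w N)) _ _))// (splitr e) ler_ltD//.
rewrite (lt_trans wx)// (lt_trans (hN N _))//.
by rewrite gtr_pMr ?divr_gt0// invf_lt1// ltr1n.
Qed.

HB.instance Definition _ := Uniform_isComplete.Build completion completion_complete.

End cauchy_sequences.

Section c0_complete.
Variable R : realType.

Lemma c0_complete (F : set_system (c0 R)) :
  ProperFilter F -> cauchy F -> cvg F.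
Proof.
move=> FF /cauchyP Fc.
have ptP n : exists l : R, (x : c0 R) n @[x --> F] --> l.
  apply/cvg_ex/cauchy_cvgP/cauchy_exP => e e0; have [x Fx] := Fc e e0.
  exists (x n); suff : F [set z : c0 R | `|x n - z n| < e] by [].
  apply: filterS Fx => z; rewrite -ball_normE /= => xz.
  by apply: le_lt_trans xz; exact: (c0_norm_ge (x - z) n).
have [y hy] := choice ptP.
have dist_y e x : 0 < e -> F (ball x e) -> forall n, `|y n - x n| <= e.
  move=> e0 Fx n.
  have h : `|(z : c0 R) n - x n| @[z --> F] --> `|y n - x n|.
    by apply: cvg_norm; apply: cvgB => //; exact: cvg_cst.
  apply: (ler_cvg_to h (cvg_cst e)); apply: filterS Fx => z.
  rewrite -ball_normE /= => /ltW xz; apply: le_trans xz.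
  by rewrite distrC; exact: (c0_norm_ge (x - z) n).
have y0 : (y : nat -> R^o) \in @c0_pred R.
  rewrite inE; apply/cvgrPdist_lt => e e0.
  have e20 : 0 < e / 2 by rewrite divr_gt0.
  have [x Fx] := Fc _ e20; have /cvgrPdist_lt/(_ _ e20) := c0_cvg x.
  apply: filterS => n; rewrite !sub0r !normrN => xn.
  rewrite -(subrK (x n) (y n)) (le_lt_trans (ler_normD _ _))//.
  by rewrite (splitr e) ler_ltD// dist_y.
apply/cvg_ex; exists (C0 y0); apply/cvgrPdist_lt => e e0.
have e30 : 0 < e / 2 / 2 by rewrite !divr_gt0.
have [x Fx] := Fc _ e30; have yx := dist_y _ _ e30 Fx.
apply: filterS Fx => z; rewrite -ball_normE /= => xz.
rewrite (le_lt_trans (ler_distD x _ _))// (splitr e) ler_ltD//.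
  rewrite (@le_trans _ _ (e / 2 / 2))//; first exact: c0_norm_le.
  by rewrite ler_piMr ?divr_ge0 ?invf_le1 ?ler1n// ltW.
by rewrite (lt_trans xz)// gtr_pMr ?divr_gt0// invf_lt1// ltr1n.
Qed.

HB.instance Definition _ := Uniform_isComplete.Build (c0 R) c0_complete.

End c0_complete.

(* The algebraic tensor product is realised inside the algebraic dual of the
   space of all (not necessarily continuous) bilinear forms [B] on [X * Y]: the
   elementary tensor of [x] and [y] is the evaluation [B |-> B x y], and a
   tensor is a finite sum of elementary ones.  Over a field, bilinear forms
   separate tensors, so this is the usual [X ⊗ Y]. *)

Section tensor.
Variables (R : realType) (X Y : lmodType R).

Definition eval_bilinear (x : X) (y : Y) : {bilinear X -> Y -> R^o} -> R^o :=
  fun B => B x y.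

Definition tensor_pred : {pred {bilinear X -> Y -> R^o} -> R^o} :=
  mem [set u | exists s : seq (X * Y),
    u = \sum_(xy <- s) eval_bilinear xy.1 xy.2].

Lemma tensor_submod_closed : submod_closed tensor_pred.
Proof.
split; first by rewrite inE; exists [::]; rewrite big_nil.
move=> a _ _ /[!inE] -[s ->] [t ->].
exists ([seq (a *: xy.1, xy.2) | xy <- s] ++ t).
rewrite big_cat big_map scaler_sumr /=; congr (_ + _); apply: eq_bigr => xy _.
by apply/funext => B; rewrite /eval_bilinear linearZl_LR.
Qed.

HB.instance Definition _ := GRing.isSubmodClosed.Build R
  ({bilinear X -> Y -> R^o} -> R^o) tensor_pred tensor_submod_closed.

Record tensor := Tensor {
  tensor_val :> {bilinear X -> Y -> R^o} -> R^o;
  tensor_valP : tensor_val \in tensor_pred }.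

HB.instance Definition _ := [isSub for tensor_val].
HB.instance Definition _ := [Choice of tensor by <:].
HB.instance Definition _ := [SubChoice_isSubLmodule of tensor by <:].

Lemma eval_bilinear_tensor x y : eval_bilinear x y \in tensor_pred.
Proof. by rewrite inE; exists [:: (x, y)]; rewrite big_seq1. Qed.

Definition tens (x : X) (y : Y) : tensor := Tensor (eval_bilinear_tensor x y).

Lemma tensDl x x' y : tens (x + x') y = tens x y + tens x' y.
Proof.
by apply/val_inj/funext => B; rewrite /= /eval_bilinear linearDl.
Qed.

Lemma tensDr x y y' : tens x (y + y') = tens x y + tens x y'.
Proof.
by apply/val_inj/funext => B; rewrite /= /eval_bilinear linearDr.
Qed.

Lemma tensZl a x y : tens (a *: x) y = a *: tens x y.
Proof.
by apply/val_inj/funext => B; rewrite /= /eval_bilinear linearZl_LR.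
Qed.

Lemma tensZr a x y : tens x (a *: y) = a *: tens x y.
Proof.
by apply/val_inj/funext => B; rewrite /= /eval_bilinear linearZr_LR.
Qed.

Lemma tensor_repr (u : tensor) :
  exists s : seq (X * Y), u = \sum_(xy <- s) tens xy.1 xy.2.
Proof.
have := tensor_valP u; rewrite inE => -[s us]; exists s.
apply/val_inj; rewrite [RHS](raddf_sum val); exact: us.
Qed.

End tensor.

Section projective_tensor.
Variables (R : realType) (X Y : normedModType R).

(* The coefficients of [u = \sum a_i x_i ⊗ y_i] are absorbed in the [x_i], so
   that representations of [u] are finite sequences of pairs. *)
Definition projective_norm (u : tensor X Y) : R :=
  inf [set \sum_(xy <- s) `|xy.1| * `|xy.2| |
       s in [set s : seq (X * Y) | u = \sum_(xy <- s) tens xy.1 xy.2]].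

Lemma projective_norm_le (s : seq (X * Y)) :
  projective_norm (\sum_(xy <- s) tens xy.1 xy.2) <=
  \sum_(xy <- s) `|xy.1| * `|xy.2|.
Proof.
apply: inf_lbound; last by exists s.
exists 0 => _ [t _ <-]; apply: sumr_ge0 => xy _; exact: mulr_ge0.
Qed.

Lemma projective_norm_approx (u : tensor X Y) (e : R) : 0 < e ->
  exists2 s : seq (X * Y), u = \sum_(xy <- s) tens xy.1 xy.2 &
    \sum_(xy <- s) `|xy.1| * `|xy.2| < projective_norm u + e.
Proof.
move=> e0; set A := [set \sum_(xy <- s) `|xy.1| * `|xy.2| |
       s in [set s : seq (X * Y) | u = \sum_(xy <- s) tens xy.1 xy.2]].
have infA : has_inf A.
  split; first by have [s us] := tensor_repr u; eexists; exists s.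
  exists 0 => _ [t _ <-]; apply: sumr_ge0 => xy _; exact: mulr_ge0.
by have [_ [s us <-] lt_s] := inf_adherent e0 infA; exists s.
Qed.

Lemma projective_norm_seminorm : seminorm projective_norm.
Proof.
have normZ_le a u : projective_norm (a *: u) <= `|a| * projective_norm u.
  apply/ler_addgt0Pr => e e0.
  have a1 : 0 < `|a| + 1 by rewrite ltr_wpDl.
  have [s us hs] := projective_norm_approx u (divr_gt0 e0 a1).
  have -> : a *: u = \sum_(xy <- [seq (a *: xy.1, xy.2) | xy <- s]) tens xy.1 xy.2.
    rewrite us big_map scaler_sumr; apply: eq_bigr => xy _.
    by rewrite tensZl.
  apply: (le_trans (projective_norm_le _)); rewrite big_map /=.
  under eq_bigr do rewrite normrZ -mulrA.
  rewrite -mulr_sumr (le_trans (ler_wpM2l _ (ltW hs)))// mulrDr lerD2l.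
  by rewrite mulrCA ger_pMr// ler_pdivrMr// mul1r lerDl.
split=> [u v|a u].
  apply/ler_addgt0Pr => e e0.
  have e20 : 0 < e / 2 by rewrite divr_gt0.
  have [s us hs] := projective_norm_approx u e20.
  have [t vt ht] := projective_norm_approx v e20.
  have -> : u + v = \sum_(xy <- s ++ t) tens xy.1 xy.2 by rewrite big_cat us vt.
  apply: (le_trans (projective_norm_le _)); rewrite big_cat (splitr e) addrACA /=.
  by rewrite lerD ?ltW.
apply/eqP; rewrite eq_le normZ_le /=.
have [->|a0] := eqVneq a 0.
  rewrite normr0 mul0r; apply: lb_le_inf.
    by have [s us] := tensor_repr (0 *: u); eexists; exists s.
  by move=> _ [t _ <-]; apply: sumr_ge0 => xy _; exact: mulr_ge0.
rewrite -ler_pdivlMl ?normr_gt0// -normfV.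
by rewrite -{1}(scalerK a0 u); exact: normZ_le.
Qed.

(* [projective_norm] is in fact a norm, so that the separation implicit in
   [completion] is trivial here; only the seminorm laws are needed to build
   the completion. *)
Definition projective_tensor : completeNormedModType R :=
  completion projective_norm_seminorm.

End projective_tensor.

Section banach.
Variables (R : realType) (E : completeNormedModType R).

Definition LASQ : Prop :=
  forall x : E, `|x| = 1 ->
  exists y : nat -> E,
    [/\ forall n, `|y n| <= 1,
        `|x + y n| @[n --> \oo] --> (1 : R),
        `|x - y n| @[n --> \oo] --> (1 : R) &
        `|y n| @[n --> \oo] --> (1 : R)].

Definition dual_space := {f : {linear E -> R^o} | continuous f}.

(* [E] with its weak topology: the coarsest one for which every element of the
   topological dual is continuous. *)
Definition weak_space : Type :=
  sup_topology (fun f : dual_space =>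
    Topological.class (initial_topology (sval f : E -> R^o))).

HB.instance Definition _ := Topological.on weak_space.

Definition weakly_open (W : set E) : Prop := open (W : set weak_space).

Definition diameter (A : set E) : \bar R :=
  ereal_sup [set `|x - y|%:E | x in A & y in A].

Definition D2P : Prop :=
  forall W : set E, weakly_open W ->
  W `&` [set x | `|x| <= 1] !=set0 ->
  diameter (W `&` [set x | `|x| <= 1]) = 2%:E.

End banach.

(* Main.v *)
(* Let [S] be the [N]-fold right shift on [c0]. Then [S ⊗ id] is isometric for
   the projective norm, and since [x] and [S x] have almost disjoint supports
   when [N] is large, [z ± (S ⊗ id) z] has norm close to that of [z]. Moreover
   [(S ⊗ id) z] tends weakly to 0 as [N] grows, because shifts are weakly null
   on [c0]. So the tensor product is weakly almost square, which gives both
   local almost squareness and the diameter two property. *)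
Require Import Defs.
From HB Require Import structures.
From mathcomp Require Import all_boot all_order all_algebra sesquilinear.
From mathcomp Require Import all_classical all_reals all_analysis lra zify.
Set Implicit Arguments.
Unset Strict Implicit.
Unset Printing Implicit Defensive.
Import Order.TTheory GRing.Theory Num.Theory.
Import numFieldNormedType.Exports.
Local Open Scope classical_set_scope.
Local Open Scope ring_scope.
Local Open Scope quotient_scope.

Lemma cvg_sum0 (R : realType) (I : Type) (r : seq I) (F : I -> nat -> R) :
  (forall i, F i n @[n --> \oo] --> (0 : R)) ->
  \sum_(i <- r) F i n @[n --> \oo] --> (0 : R).
Proof.
move=> F0; elim: r => [|i r IHr].
  by under eq_fun do rewrite big_nil; exact: cvg_cst.
under eq_fun do rewrite big_cons.
have := cvgD (F0 i) IHr; rewrite addr0; apply.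
Qed.

(** * Right and left shifts on [c0] *)

Lemma c0_shift_subproof (R : realType) (N : nat) (x : c0 R) :
  ((fun n => if (n < N)%N then 0 else x (n - N)%N) : nat -> R^o) \in @c0_pred R.
Proof.
rewrite inE /= -(cvg_shiftn N) /=.
rewrite (_ : (fun _ => _) = (x : nat -> R)); first exact: c0_cvg.
by apply/funext => n; rewrite ltnNge leq_addl addnK.
Qed.

Definition c0_shift (R : realType) (N : nat) (x : c0 R) : c0 R :=
  C0 (c0_shift_subproof N x).

Lemma c0_shift_is_linear (R : realType) N : linear (@c0_shift R N).
Proof.
move=> a x y; apply/val_inj/funext => n /=.
transitivity (a *: (if (n < N)%N then 0 else x (n - N)%N : R^o) +
  (if (n < N)%N then 0 else y (n - N)%N)) => //.
by case: ifP => // _; rewrite scaler0 addr0.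
Qed.

HB.instance Definition _ (R : realType) N :=
  GRing.isLinear.Build R (c0 R) (c0 R) _
    (@c0_shift R N) (@c0_shift_is_linear R N).

Lemma c0_unshift_subproof (R : realType) (N : nat) (x : c0 R) :
  ((fun n => x (n + N)%N) : nat -> R^o) \in @c0_pred R.
Proof. by rewrite inE /= (cvg_shiftn N (x : nat -> R)); exact: c0_cvg. Qed.

(** A contractive left inverse of [c0_shift N]; its norm at [x] measures the tail of [x] from
    position [N] on. *)
Definition c0_unshift (R : realType) (N : nat) (x : c0 R) : c0 R :=
  C0 (c0_unshift_subproof N x).

Lemma c0_unshift_is_linear (R : realType) N : linear (@c0_unshift R N).
Proof. by move=> a x y; apply/val_inj/funext. Qed.

HB.instance Definition _ (R : realType) N :=
  GRing.isLinear.Build R (c0 R) (c0 R) _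
    (@c0_unshift R N) (@c0_unshift_is_linear R N).

Lemma c0_shiftE (R : realType) N (x : c0 R) n :
  c0_shift N x n = if (n < N)%N then 0 else x (n - N)%N.
Proof. by []. Qed.

Lemma c0_shiftK (R : realType) N : cancel (@c0_shift R N) (@c0_unshift R N).
Proof.
by move=> x; apply/val_inj/funext => n /=; rewrite ltnNge leq_addl addnK.
Qed.

Lemma c0_shiftD (R : realType) M N (x : c0 R) :
  c0_shift M (c0_shift N x) = c0_shift (M + N) x.
Proof.
apply/val_inj/funext => n /=; case: (ltnP n M) => [nM|Mn].
  by rewrite ltn_addr.
by rewrite ltn_subLR// subnDA.
Qed.

Lemma c0_addE (R : realType) (x y : c0 R) n : (x + y) n = x n + y n.
Proof. by []. Qed.

Lemma c0_scaleE (R : realType) (a : R) (x : c0 R) n : (a *: x) n = a * x n.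
Proof. by []. Qed.

Lemma c0_coord_le (R : realType) (x : c0 R) n : `|x n| <= `|x|.
Proof. exact: c0_norm_ge. Qed.

Lemma c0_norm_leP (R : realType) (x : c0 R) (r : R) :
  (forall n, `|x n| <= r) -> `|x| <= r.
Proof. exact: c0_norm_le. Qed.

Lemma c0_shift_le (R : realType) N (x : c0 R) : `|c0_shift N x| <= `|x|.
Proof.
apply: c0_norm_leP => n; rewrite c0_shiftE; case: ifP => _; last first.
  exact: (c0_coord_le x (n - N)).
by rewrite normr0 normr_ge0.
Qed.

Lemma c0_unshift_le (R : realType) N (x : c0 R) : `|c0_unshift N x| <= `|x|.
Proof. by apply: c0_norm_leP => n; exact: (c0_coord_le x (n + N)). Qed.

Lemma c0_unshift_cvg0 (R : realType) (x : c0 R) :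
  `|c0_unshift N x| @[N --> \oo] --> (0 : R).
Proof.
apply/cvgrPdist_le => e e0.
have /cvgrPdist_le/(_ _ e0)[N _ hN] := c0_cvg x.
exists N => // n /= Nn; rewrite sub0r normrN normr_id.
apply: c0_norm_leP => k; have := hN (k + n)%N; rewrite sub0r normrN; apply.
by rewrite /= (leq_trans Nn)// leq_addl.
Qed.

(* Beyond position [N] the coordinates of [x] are those of [c0_unshift N x];
   below [N] the shifted copy vanishes. *)
Lemma c0_norm_add_shift (R : realType) N (a : R) (x : c0 R) : `|a| <= 1 ->
  `|x + a *: c0_shift N x| <= `|x| + `|c0_unshift N x|.
Proof.
move=> a1; apply: c0_norm_leP => n.
rewrite c0_addE c0_scaleE c0_shiftE.
case: ltnP => Nn.
  by rewrite mulr0 addr0 (le_trans (c0_coord_le x n))// lerDl.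
rewrite addrC (le_trans (ler_normD _ _))// lerD//.
  by rewrite normrM (le_trans _ (c0_coord_le x (n - N)))// ler_piMl.
by have := c0_coord_le (c0_unshift N x) (n - N); rewrite /= subnK.
Qed.

(** * Unit vectors of [c0] and weak nullity of the shifts *)

Lemma c0_delta0_subproof (R : realType) :
  ((fun n => (n == 0%N)%:R) : nat -> R^o) \in @c0_pred R.
Proof.
rewrite inE /= -(cvg_shiftn 1) /=.
by under eq_fun do rewrite addn1; exact: cvg_cst.
Qed.

Definition c0_delta0 (R : realType) : c0 R := C0 (c0_delta0_subproof R).

Lemma c0_sumE (R : realType) (I : Type) (r : seq I) (F : I -> c0 R) n :
  (\sum_(i <- r) F i) n = \sum_(i <- r) F i n.
Proof. by elim/big_ind2 : _ => // x a y b <- <-. Qed.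

Lemma c0_shift_deltaE (R : realType) k n :
  c0_shift k (c0_delta0 R) n = (n == k)%:R.
Proof.
rewrite c0_shiftE /=; case: ltnP => kn; first by rewrite ltn_eqF.
by congr (nat_of_bool _)%:R; lia.
Qed.

Lemma c0_sum_deltaE (R : realType) (a : nat -> R) m n :
  (\sum_(0 <= k < m) a k *: c0_shift k (c0_delta0 R)) n =
  if (n < m)%N then a n else 0.
Proof.
rewrite c0_sumE; under eq_bigr do rewrite c0_scaleE c0_shift_deltaE.
rewrite big_mkord; case: ltnP => nm.
  rewrite (bigD1 (Ordinal nm))//= eqxx mulr1 big1 ?addr0// => i.
  by rewrite -val_eqE /= eq_sym => /negPf ->; rewrite mulr0.
by apply: big1 => i _; rewrite gtn_eqF ?mulr0// (leq_trans _ nm).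
Qed.

Lemma c0_decomp (R : realType) m (x : c0 R) :
  x = \sum_(0 <= k < m) x k *: c0_shift k (c0_delta0 R) +
      c0_shift m (c0_unshift m x).
Proof.
apply/val_inj/funext => n.
rewrite [RHS]c0_addE c0_sum_deltaE c0_shiftE.
by case: ltnP => mn; rewrite ?addr0// add0r /= subnK.
Qed.

(* A bounded functional on [c0] has absolutely summable values on the unit
   vectors, as one sees by testing it on sums of signed unit vectors. *)
Lemma bounded_delta_cvg0 (R : realType) (g : {linear c0 R -> R^o}) (C : R) :
  (forall x, `|g x| <= C * `|x|) ->
  g (c0_shift n (c0_delta0 R)) @[n --> \oo] --> (0 : R).
Proof.
move=> gC; apply/norm_cvg0P; apply: cvg_series_cvg_0.
have C0 : 0 <= C.
  have := le_trans (normr_ge0 _) (gC (c0_delta0 R)).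
  rewrite pmulr_lge0// normr_gt0; apply/eqP.
  move=> /(congr1 (fun x : c0 R => x 0%N)).
  by move/eqP; rewrite /= oner_eq0.
apply: nondecreasing_is_cvgn.
  by apply: nondecreasing_series => n _ _; exact: normr_ge0.
exists C => _ [m _ <-]; rewrite /series /=.
pose x := \sum_(0 <= k < m)
  Num.sg (g (c0_shift k (c0_delta0 R))) *: c0_shift k (c0_delta0 R).
have -> : \sum_(0 <= k < m) `|g (c0_shift k (c0_delta0 R))| = g x.
  by rewrite linear_sum; apply: eq_bigr => k _; rewrite linearZ normrEsg.
rewrite (le_trans (ler_norm _))// (le_trans (gC x))// ler_piMr//.
apply: c0_norm_leP => n; rewrite c0_sum_deltaE; case: ifP => _.
  by rewrite normr_sg lern1 leq_b1.
by rewrite normr0.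
Qed.

(** Cut [x] at a fixed [m]: the finite part is moved onto unit vectors of index tending to infinity,
    where [g] tends to 0, and the tail contributes little uniformly in [N] because shifts are
    contractions. *)
Lemma bounded_c0_shift_cvg0 (R : realType) (g : {linear c0 R -> R^o}) (C : R) :
  (forall x, `|g x| <= C * `|x|) -> forall x,
  g (c0_shift N x) @[N --> \oo] --> (0 : R).
Proof.
move=> gC x; apply/cvgrPdist_le => e e0.
have e20 : 0 < e / 2 by rewrite divr_gt0.
have [m hm] : exists m, `|C| * `|c0_unshift m x| <= e / 2.
  have : `|C| * `|c0_unshift m x| @[m --> \oo] --> (0 : R).
    by rewrite -(mulr0 `|C|); apply: cvgMl_tmp; exact: c0_unshift_cvg0.
  move=> /cvgrPdist_le/(_ _ e20)[m _ hm]; exists m.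
  by have := hm m (leqnn m); rewrite sub0r normrN ger0_norm// mulr_ge0.
pose h N := \sum_(0 <= k < m) x k * g (c0_shift N (c0_shift k (c0_delta0 R))).
have : h N @[N --> \oo] --> (0 : R).
  apply: cvg_sum0 => k; rewrite -(mulr0 (x k)); apply: cvgMl_tmp.
  under eq_fun do rewrite c0_shiftD.
  have := bounded_delta_cvg0 gC.
  by rewrite -(cvg_shiftn k).
move=> /cvgrPdist_le/(_ _ e20); apply: filterS => N.
rewrite !sub0r !normrN => hN.
have -> : g (c0_shift N x) = h N + g (c0_shift N (c0_shift m (c0_unshift m x))).
  rewrite {1}(c0_decomp m x) !linearD /= !linear_sum; congr (_ + _).
  by apply: eq_bigr => k _; rewrite !linearZ.
rewrite (le_trans (ler_normD _ _))// (splitr e) lerD// (le_trans _ hm)//.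
rewrite (le_trans (gC _))// (le_trans (ler_wpM2r _ (ler_norm C)))// ler_wpM2l//.
by rewrite (le_trans (c0_shift_le _ _))// c0_shift_le.
Qed.

(** * The map [T ⊗ id] on algebraic tensors *)

Definition precomp_bilinear (R : realType) (X X' Y : lmodType R)
    (T : {linear X -> X'}) (B : {bilinear X' -> Y -> R^o}) : X -> Y -> R^o :=
  fun x y => B (T x) y.

Lemma precomp_bilinear_subproof (R : realType) (X X' Y : lmodType R)
    (T : {linear X -> X'}) (B : {bilinear X' -> Y -> R^o}) :
  bilinear_for *:%R *:%R (precomp_bilinear T B).
Proof.
split=> [y a x x'|x a y y']; rewrite /precomp_bilinear.
  by rewrite linearP linearPl.
by rewrite linearPr.
Qed.

HB.instance Definition _ (R : realType) (X X' Y : lmodType R)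
    (T : {linear X -> X'}) (B : {bilinear X' -> Y -> R^o}) :=
  bilinear_isBilinear.Build R X Y R^o _ _ (precomp_bilinear T B)
    (precomp_bilinear_subproof T B).

Lemma tensor_sumE (R : realType) (X Y : lmodType R) (s : seq (X * Y)) B :
  (\sum_(xy <- s) tens xy.1 xy.2) B = \sum_(xy <- s) B xy.1 xy.2.
Proof.
elim: s => [|xy s IHs]; first by rewrite !big_nil.
by rewrite !big_cons -IHs.
Qed.

Lemma tensor_map_subproof (R : realType) (X X' Y : lmodType R)
    (T : {linear X -> X'}) (u : tensor X Y) :
  (fun B : {bilinear X' -> Y -> R^o} => u (precomp_bilinear T B)) \in
    @tensor_pred R X' Y.
Proof.
have [s ->] := tensor_repr u; rewrite inE.
exists [seq (T xy.1, xy.2) | xy <- s]; apply/funext => B.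
rewrite tensor_sumE big_map.
by elim/big_ind2 : _ => // x f y g -> ->.
Qed.

(** This is [T ⊗ id]. Tensors being functionals on bilinear forms, it is the transpose of
    precomposition with [T], so no independence of the representation has to be checked. *)
Definition tensor_map (R : realType) (X X' Y : lmodType R)
    (T : {linear X -> X'}) (u : tensor X Y) : tensor X' Y :=
  Tensor (tensor_map_subproof T u).

Lemma tensor_map_is_linear (R : realType) (X X' Y : lmodType R)
  (T : {linear X -> X'}) : linear (@tensor_map R X X' Y T).
Proof. by move=> a u v; apply/val_inj/funext. Qed.

HB.instance Definition _ (R : realType) (X X' Y : lmodType R)
    (T : {linear X -> X'}) :=
  GRing.isLinear.Build R (tensor X Y) (tensor X' Y) _ (@tensor_map R X X' Y T)
    (@tensor_map_is_linear R X X' Y T).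

Lemma tensor_map_tens (R : realType) (X X' Y : lmodType R)
  (T : {linear X -> X'}) x (y : Y) : tensor_map T (tens x y) = tens (T x) y.
Proof. exact/val_inj. Qed.

Lemma tensor_map_sum (R : realType) (X X' Y : lmodType R)
  (T : {linear X -> X'}) (s : seq (X * Y)) :
  tensor_map T (\sum_(xy <- s) tens xy.1 xy.2) =
  \sum_(xy <- s) tens (T xy.1) xy.2.
Proof.
by rewrite linear_sum; apply: eq_bigr => xy _; exact: tensor_map_tens.
Qed.

Lemma tensor_mapK (R : realType) (X X' Y : lmodType R)
  (T : {linear X -> X'}) (T' : {linear X' -> X}) :
  cancel T T' -> cancel (@tensor_map R X X' Y T) (tensor_map T').
Proof.
move=> TK u; have [s ->] := tensor_repr u.
by rewrite tensor_map_sum linear_sum; apply: eq_bigr => xy _;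
  rewrite /= tensor_map_tens TK.
Qed.

(** * Shifts and the projective norm *)

Lemma projective_norm_map (R : realType) (X X' Y : normedModType R)
  (T : {linear X -> X'}) (u : tensor X Y) : (forall x, `|T x| <= `|x|) ->
  projective_norm (tensor_map T u) <= projective_norm u.
Proof.
move=> T1; apply/ler_addgt0Pr => e e0.
have [s us hs] := projective_norm_approx u e0.
rewrite (le_trans _ (ltW hs))// us tensor_map_sum.
have := projective_norm_le [seq (T xy.1, xy.2) | xy <- s].
rewrite !big_map => /le_trans; apply.
by apply: ler_sum => xy _; rewrite ler_wpM2r/= ?T1.
Qed.

(** The shift and its left inverse are both contractions, hence so are the maps they induce on
    tensors. *)
Lemma projective_norm_shift (R : realType) (X : normedModType R) N
  (u : tensor (c0 R) X) :
  projective_norm (tensor_map (@c0_shift R N) u) = projective_norm u.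
Proof.
apply/le_anti; rewrite projective_norm_map; last exact: c0_shift_le.
rewrite -{1}(tensor_mapK (@c0_shiftK R N) u) projective_norm_map//.
exact: c0_unshift_le.
Qed.

(** Fix one almost optimal representation of [u]. Replacing each first factor by its sum with [a]
    times its shift costs only a finite sum of tails, which vanishes as [N] grows. *)
Lemma projective_norm_add_shift (R : realType) (X : normedModType R) (a : R)
  (u : tensor (c0 R) X) (e : R) : `|a| <= 1 -> 0 < e ->
  \forall N \near \oo,
    projective_norm (u + a *: tensor_map (@c0_shift R N) u) <=
    projective_norm u + e.
Proof.
move=> a1 e0; have e20 : 0 < e / 2 by rewrite divr_gt0.
have [s us hs] := projective_norm_approx u e20.
have : \sum_(xy <- s) `|c0_unshift N xy.1| * `|xy.2| @[N --> \oo] --> (0 : R).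
  apply: cvg_sum0 => xy; rewrite -(mul0r `|xy.2|); apply: cvgMr_tmp.
  exact: c0_unshift_cvg0.
move=> /cvgrPdist_le/(_ _ e20); apply: filterS => N.
rewrite sub0r normrN => /(le_trans (ler_norm _)) hN.
have := projective_norm_le [seq (xy.1 + a *: c0_shift N xy.1, xy.2) | xy <- s].
rewrite !big_map /=; under eq_bigr do rewrite tensDl tensZl.
rewrite big_split /= -scaler_sumr -tensor_map_sum -us => /le_trans; apply.
rewrite (splitr e) addrA (le_trans _ (lerD (ltW hs) hN))// -big_split /=.
by apply: ler_sum => xy _; rewrite -mulrDl ler_wpM2r// c0_norm_add_shift.
Qed.

(** By linearity an elementary tensor suffices; with [y] fixed, [g (tens x y)] is a bounded
    functional of [x] in [c0]. *)
Lemma bounded_tensor_shift_cvg0 (R : realType) (X : normedModType R)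
  (g : {linear tensor (c0 R) X -> R^o}) (C : R) :
  (forall u, `|g u| <= C * projective_norm u) -> forall u,
  g (tensor_map (@c0_shift R N) u) @[N --> \oo] --> (0 : R).
Proof.
move=> gC u; have [s ->] := tensor_repr u.
have -> : (fun N => g (tensor_map (@c0_shift R N)
      (\sum_(xy <- s) tens xy.1 xy.2))) =
    fun N => \sum_(xy <- s) g (tens (c0_shift N xy.1) xy.2).
  by apply/funext => N; rewrite tensor_map_sum linear_sum.
apply: cvg_sum0 => -[x y] /=.
have gl : linear (fun x => g (tens x y)).
  by move=> a z t; rewrite tensDl tensZl linearP.
pose gL : {linear c0 R -> R^o} :=
  HB.pack (fun x => g (tens x y)) (GRing.isLinear.Build R (c0 R) R^o _ _ gl).
apply: (@bounded_c0_shift_cvg0 R gL (`|C| * `|y|)) => z /=.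
rewrite (le_trans (gC _))// (le_trans (ler_wpM2r _ (ler_norm C)))//.
  exact: (seminorm_ge0 (projective_norm_seminorm _ _)).
rewrite -mulrA ler_wpM2l//.
by have := projective_norm_le [:: (z, y)]; rewrite !big_seq1 /= mulrC.
Qed.

(** * Extension of isometries to the completion *)

Lemma completion_isometry_ext (R : realType) (V : lmodType R) (p : V -> R)
    (hp : seminorm p) (A : {linear V -> V}) :
  (forall v, p (A v) = p v) ->
  exists2 T : completion hp -> completion hp,
    forall x y, `|T x - T y| = `|x - y| &
    forall v, T (to_completion hp v) = to_completion hp (A v).
Proof.
move=> pA.
have Ac (u : cauchy_seqs hp) : (fun n => A (u n)) \in cauchy_seq_pred hp.
  rewrite inE => e e0; have [N hN] := cauchy_seqP u e0.
  by exists N => m n Nm Nn; rewrite -linearB pA; exact: hN.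
pose A' u := CauchySeq (Ac u).
have A'B u v : A' (u - v) = A' u - A' v.
  by apply/val_inj/funext => n /=; exact: linearB.
have A'norm u : `|\pi_(completion hp) (A' u)| = `|\pi_(completion hp) u|.
  apply: (cvg_unique (@Rhausdorff R) (completion_norm_class (u := A' u))).
  rewrite (_ : p \o A' u = p \o u); first exact: completion_norm_class.
  by apply/funext => n /=.
(* [A] acts termwise on a chosen representative; since [A'] preserves the norm of classes, two
   representatives of one class have images of the same class. *)
exists (fun x => \pi_(completion hp) (A' (repr x))) => [x y|v].
  by rewrite -classN -classD -A'B A'norm classD classN !reprK.
rewrite /to_completion; set w := CauchySeq _.
transitivity (\pi_(completion hp) (A' w)); last first.
  by congr (\pi _); exact: val_inj.
apply/subr0_eq/eqP; rewrite -normr_eq0 -classN -classD -A'B A'norm.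
by rewrite classD classN reprK subrr normr0.
Qed.

(** * Weakly almost square spaces and the diameter two property *)

Definition weakly_null (R : realType) (E : normedModType R) (y : nat -> E) :=
  forall f : {linear E -> R^o}, continuous f ->
    f (y n) @[n --> \oo] --> (0 : R).

(* Weakly almost square spaces: local almost squareness witnessed by a weakly
   null sequence. *)
Definition WASQ (R : realType) (E : normedModType R) : Prop :=
  forall x : E, `|x| = 1 -> exists y : nat -> E,
  [/\ forall n, `|y n| <= 1,
      `|x + y n| @[n --> \oo] --> (1 : R),
      `|x - y n| @[n --> \oo] --> (1 : R),
      `|y n| @[n --> \oo] --> (1 : R) &
      weakly_null y].

Lemma WASQ_LASQ (R : realType) (E : completeNormedModType R) : WASQ E -> LASQ E.
Proof. by move=> h x /h[y []]; exists y. Qed.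

Lemma weakly_open_near (R : realType) (E : completeNormedModType R)
    (W : set E) (x : E) (u : nat -> E) : weakly_open W -> W x ->
  (forall f : {linear E -> R^o}, continuous f ->
    f (u n) @[n --> \oo] --> (f x : R)) ->
  \forall n \near \oo, W (u n).
Proof.
move=> Wo Wx ux.
have h : (u @ \oo) --> (x : weak_space E).
  apply/cvg_sup => -[f fc] A [_ [[C Co <-] /= Cx CA]].
  have fxC : nbhs (f x) C by exact: open_nbhs_nbhs.
  by apply: (@filterS _ \oo) (ux f fc C fxC) => n; exact: CA.
by apply: (h W); rewrite nbhsE /=; exists W.
Qed.

(** At [t = 2 / r] the vector [t *: v] has norm at least 2 and [w] at most 1, so the sum is outside
    the open unit ball; at [t = 0] it is in the closed ball. *)
Lemma norm_line_IVT (R : realType) (E : normedModType R) (w v : E) (r : R) :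
  `|w| <= 1 -> 0 < r -> r <= `|v| ->
  exists2 t : R, `|t| <= 2 / r & `|w + t *: v| = 1.
Proof.
move=> w1 r0 rv.
have b0 : 0 <= 2 / r by rewrite divr_ge0// ltW.
have fc : continuous (fun t : R => `|w + t *: v|).
  move=> t; apply: cvg_norm; apply: cvgD; first exact: cvg_cst.
  by apply: cvgZr_tmp; exact: cvg_id.
have [||t] := @IVT R (fun t => `|w + t *: v|) 0 (2 / r) 1 b0.
- exact: continuous_subspaceT.
- rewrite scale0r addr0 ge_min w1 /= le_max; apply/orP; right.
  rewrite addrC (le_trans _ (lerB_normD _ _))// lerBrDr.
  rewrite normrZ ger0_norm// mulrAC ler_pdivlMr//.
  by rewrite ler_pM ?addr_ge0 ?(ltW r0)// -[leRHS]/(1 + 1) lerD2l.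
rewrite in_itv /= => /andP[t0 tb] tE; exists t => //.
by rewrite ger0_norm.
Qed.

(* A weak neighbourhood of a point of the ball contains a point [z] of the
   sphere, obtained by moving along a weakly null sequence; it then contains
   the normalised points [z + y n] and [z - y n], at distance close to 2. *)
Lemma WASQ_D2P (R : realType) (E : completeNormedModType R) :
  WASQ E -> (exists e : E, e != 0) -> D2P E.
Proof.
move=> wasq [e0 e0N0] W Wo [w [Ww /= w1]].
have [|v [_ _ _ v1 vw]] := wasq (`|e0|^-1 *: e0).
  by rewrite normrZ normfV normr_id mulVf// normr_eq0.
have half : (2 : R)^-1 < 1 by rewrite invf_lt1// ltr1n.
(* The bound 4 is [2 / r] for [r = 2^-1], a lower bound of [|v n|] for large [n]. The other indices
   take [t = 0], so the coefficients are uniformly bounded and [t n *: v n] is still weakly null. *)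
have /choice[t ht] n : exists t : R, `|t| <= 4 /\
    (2^-1 <= `|v n| -> `|w + t *: v n| = 1).
  have [vn|vn] := leP 2^-1 `|v n|; last by exists 0; rewrite normr0; split.
  have [//|t tb tE] := norm_line_IVT w1 _ vn; exists t; split => //.
  by rewrite (le_trans tb)// invrK -natrM.
have [z [Wz z1]] : exists z, W z /\ `|z| = 1.
  have : \forall n \near \oo, W (w + t n *: v n).
    apply: (weakly_open_near Wo Ww) => f fc.
    have -> : (fun n => f (w + t n *: v n)) = fun n => f w + t n * f (v n).
      by apply/funext => n; rewrite linearD linearZ.
    rewrite -[X in _ --> X]addr0; apply: cvgD; first exact: cvg_cst.
    apply/norm_cvg0P; apply: (@squeeze_cvgr _ _ _ _ (cst 0)
      (fun n => 4 * `|f (v n)|)).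
    - apply: nearW => n; rewrite normr_ge0 normrM ler_wpM2r//.
      by case: (ht n).
    - exact: cvg_cst.
    - rewrite -[X in _ --> X](mulr0 4); apply: cvgMl_tmp.
      by apply/norm_cvg0P; exact: vw.
  move=> Wn; have vn : \forall n \near \oo, 2^-1 < `|v n|.
    exact: cvgr_gt v1 _ half.
  have [n [/= Wn' /ltW vn']] := filter_ex (filterI Wn vn).
  by exists (w + t n *: v n); split => //; case: (ht n) => _; apply.
have [y [y1 zDy zBy yn yw]] := wasq z z1.
(* A common bound for the norms of [z + y n] and [z - y n] that tends to 1: dividing both by it puts
   them in the ball and keeps their difference a multiple of [y n]. *)
pose d n := 1 + `| `|z + y n| - 1| + `| `|z - y n| - 1|.
have d0 n : 0 < d n by rewrite !ltr_wpDr.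
have dist1 (u : nat -> R) : u n @[n --> \oo] --> (1 : R) ->
    `|u n - 1| @[n --> \oo] --> (0 : R).
  move=> u1; apply/norm_cvg0P; rewrite -[X in _ --> X](subrr 1).
  by apply: cvgB => //; exact: cvg_cst.
pose c n := (d n)^-1.
have c1 : c n @[n --> \oo] --> (1 : R).
  rewrite -[X in _ --> X]invr1; apply: cvgV; first exact: oner_neq0.
  rewrite -[X in _ --> X]addr0; apply: cvgD; last exact: dist1.
  rewrite -[X in _ --> X]addr0; apply: cvgD; last exact: dist1.
  exact: cvg_cst.
have c0 n : 0 <= c n by rewrite invr_ge0 ltW.
pose a n := c n *: (z + y n); pose b n := c n *: (z - y n).
have weak (s : R) : \forall n \near \oo, W (c n *: (z + s *: y n)).
  apply: (weakly_open_near Wo Wz) => f fc.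
  have -> : (fun n => f (c n *: (z + s *: y n))) =
      fun n => c n * (f z + s * f (y n)).
    by apply/funext => n; rewrite linearZ linearD linearZ.
  rewrite -[X in _ --> X]mul1r; apply: cvgM => //.
  rewrite -[X in _ --> X]addr0; apply: cvgD; first exact: cvg_cst.
  by rewrite -[X in _ --> X](mulr0 s); apply: cvgMl_tmp; exact: yw.
have aW : \forall n \near \oo, W (a n).
  by have := weak 1; under eq_near do rewrite scale1r.
have bW : \forall n \near \oo, W (b n).
  by have := weak (-1); under eq_near do rewrite scaleN1r.
have a1 n : `|a n| <= 1.
  rewrite normrZ ger0_norm// mulrC ler_pdivrMr// mul1r.
  by rewrite ler_wpDr// -lerBlDl ler_norm.
have b1 n : `|b n| <= 1.
  rewrite normrZ ger0_norm// mulrC ler_pdivrMr// mul1r.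
  by rewrite /d addrAC ler_wpDr// -lerBlDl ler_norm.
have ab : `|a n - b n| @[n --> \oo] --> (2 : R).
  have -> : (fun n => `|a n - b n|) = fun n => c n * (2 * `|y n|).
    apply/funext => n; rewrite /a /b -scalerBr normrZ ger0_norm//.
    by rewrite opprB addrC addrA subrK -mulr2n normrMn mulr_natl.
  rewrite -[X in _ --> X]mul1r; apply: cvgM => //.
  by rewrite -[X in _ --> X]mulr1; apply: cvgMl_tmp.
apply/eqP; rewrite eq_le; apply/andP; split.
  apply: ge_ereal_sup => _ [p [_ /= p1]] [q [_ /= q1]] <-.
  by rewrite lee_fin (le_trans (ler_normB _ _))// -[leRHS]/(1 + 1) lerD.
apply/lee_subgt0Pr => r r0.
have abr : \forall n \near \oo, 2 - r <= `|a n - b n|.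
  by apply: (cvgr_ge _ ab); rewrite ltrBlDr ltrDl.
have [n [[/= Wa Wb] abn]] := filter_ex (filterI (filterI aW bW) abr).
apply: (@le_trans _ _ `|a n - b n|%:E); first by rewrite lee_fin.
apply: ereal_sup_ubound; exists (a n); first by split => //=.
by exists (b n) => //; split => //=.
Qed.

(** * The tensor product is non-zero *)

(* The form sends [x] to the only [a] such that [x - a *: v] lies in a subspace
   maximal among those avoiding [v]. It is not continuous in general, which is
   harmless because tensors are tested against all bilinear forms. *)
Lemma linear_form_separates (R : realType) (X : lmodType R) (v : X) :
  v != 0 -> exists g : {linear X -> R^o}, g v = 1.
Proof.
move=> v0.
pose P (M : set X) := ~ M v /\ forall a x y, M x -> M y -> M (a *: x + y).
have [|M [[Mv Ml] Mmax]] := @Zorn_bigcup X P.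
  move=> F FP Ftot; split=> [[M FM Mv]|a x y [M FM Mx] [N FN Ny]].
    by have [] := FP _ FM.
  have [MN|NM] := Ftot _ _ FM FN.
    by exists N => //; have [_] := FP _ FN; apply => //; exact: MN.
  by exists M => //; have [_] := FP _ FM; apply => //; exact: NM.
(* The empty set satisfies [P], as the union of the empty chain must. If [M] missed 0 it would be
   empty, and the singleton of 0 would contradict maximality. *)
have M0 : M 0.
  apply: contrapT => M0; apply: (Mmax [set 0]); last first.
    split=> /= [/eqP|a x y -> ->]; first by rewrite (negPf v0).
    by rewrite scaler0 addr0.
  have Mempty x : ~ M x.
    by move=> Mx; apply: M0; rewrite -(addNr x) -scaleN1r; exact: Ml.
  by split=> [x /Mempty|/(_ 0 erefl)].
have MZ a x : M x -> M (a *: x) by move=> Mx; rewrite -[_ *: _]addr0; exact: Ml.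
have MD x y : M x -> M y -> M (x + y).
  by move=> Mx; rewrite -[x]scale1r; exact: Ml.
have MB x y : M x -> M y -> M (x - y).
  by move=> Mx My; rewrite -scaleN1r; apply/MD/MZ.
have ex x : exists a, M (x - a *: v).
  have [Mx|Mx] := pselect (M x); first by exists 0; rewrite scale0r subr0.
  apply: contrapT => /forallNP xa.
  (* This is the span of [M] and [x]. If it contained [v] with coefficient [b], then [b] would be
     non-zero, and [x - b^-1 *: v] would lie in [M]. *)
  apply: (Mmax [set y | exists b, M (y - b *: x)]).
    split=> [y My|h]; first by exists 0; rewrite scale0r subr0.
    by apply/Mx/h; exists 1; rewrite scale1r subrr.
  split=> /= [[b Mb]|a y z [b Mb] [c Mc]].
    have b0 : b != 0.
      by apply: contra_notN Mv => /eqP b0; move: Mb; rewrite b0 scale0r subr0.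
    apply: (xa b^-1); have := MZ (- b^-1) _ Mb.
    by rewrite scalerBr scaleNr scaleNr opprK scalerA mulVf// scale1r addrC.
  exists (a * b + c); have := Ml a _ _ Mb Mc.
  by rewrite scalerBr scalerA scalerDl opprD addrACA.
have [g gM] := choice ex.
have gE x a : M (x - a *: v) -> g x = a.
  move=> Ma; apply/eqP; rewrite -subr_eq0; apply: contra_notT Mv => ga.
  have := MZ (g x - a)^-1 _ (MB _ _ Ma (gM x)).
  have -> : x - a *: v - (x - g x *: v) = (g x - a) *: v.
    by rewrite opprB addrC addrA subrK scalerBl.
  by rewrite scalerA mulVf ?scale1r.
have gl : linear (g : X -> R^o).
  move=> a x y; apply: gE; rewrite scalerDl opprD addrACA -scalerA -scalerBr.
  exact: Ml.
pose gL : {linear X -> R^o} :=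
  HB.pack (g : X -> R^o) (GRing.isLinear.Build R X R^o _ _ gl).
by exists gL; apply: gE; rewrite scale1r subrr.
Qed.

Definition coord_bilinear (R : realType) (X : lmodType R)
    (g : {linear X -> R^o}) : c0 R -> X -> R^o := fun a x => a 0%N *: g x.

Lemma coord_bilinear_subproof (R : realType) (X : lmodType R)
  (g : {linear X -> R^o}) : bilinear_for *:%R *:%R (coord_bilinear g).
Proof.
split=> [x k a b|a k x y]; rewrite /coord_bilinear.
  rewrite c0_addE c0_scaleE scalerDl; congr (_ + _); exact/esym/mulrA.
rewrite linearP scalerDr; congr (_ + _); exact: mulrCA.
Qed.

HB.instance Definition _ (R : realType) (X : lmodType R)
    (g : {linear X -> R^o}) :=
  bilinear_isBilinear.Build R (c0 R) X R^o _ _ (coord_bilinear g)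
    (coord_bilinear_subproof g).

(** Otherwise some representation costs less than [|x|]. Contracting its first factors by the
    coordinate 0 gives a vector of norm less than [|x|], hence different from [x]; but no linear
    form [g] tells the two apart, as evaluation at [coord_bilinear g] shows. *)
Lemma projective_norm_delta (R : realType) (X : normedModType R) (x : X) :
  x != 0 -> projective_norm (tens (c0_delta0 R) x) != 0.
Proof.
move=> x0; apply/eqP => p0.
have nx : 0 < `|x| by rewrite normr_gt0.
have [s us] := projective_norm_approx (tens (c0_delta0 R) x) nx.
rewrite p0 add0r => hs.
have [|g gv] :=
  @linear_form_separates R X (x - \sum_(xy <- s) xy.1 0%N *: xy.2).
  rewrite subr_eq0; apply: contraTneq hs => xE; rewrite -leNgt {1}xE.
  rewrite (le_trans (ler_norm_sum _ _ _))//; apply: ler_sum => xy _.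
  by rewrite normrZ ler_wpM2r// c0_coord_le.
have := congr1 (fun u : tensor (c0 R) X => u (coord_bilinear g)) us.
rewrite tensor_sumE /= /eval_bilinear /= /coord_bilinear /= scale1r => gx.
move: gv; rewrite linearB linear_sum /= gx.
under [X in _ - X]eq_bigr do rewrite linearZ.
by rewrite subrr => /esym/eqP; rewrite oner_eq0.
Qed.

Lemma projective_tensor_neq0 (R : realType) (X : normedModType R) :
  (exists x : X, x != 0) -> exists e : projective_tensor (c0 R) X, e != 0.
Proof.
move=> [x x0].
exists (to_completion (projective_norm_seminorm _ _) (tens (c0_delta0 R) x)).
by rewrite -normr_eq0 to_completion_norm projective_norm_delta.
Qed.

(** * Shifted copies in the completed tensor product *)

Lemma projective_tensor_WASQ (R : realType) (X : normedModType R) :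
  WASQ (projective_tensor (c0 R) X).
Proof.
set hp := projective_norm_seminorm (c0 R) X.
have /choice[T hT] N : exists T : completion hp -> completion hp,
    (forall x y, `|T x - T y| = `|x - y|) /\
    forall v, T (to_completion hp v) =
      to_completion hp (tensor_map (@c0_shift R N) v).
  have [T] := completion_isometry_ext hp (@projective_norm_shift R X N).
  by exists T.
have Tdist N x y : `|T N x - T N y| = `|x - y| by case: (hT N).
have TE N v : T N (to_completion hp v) =
    to_completion hp (tensor_map (@c0_shift R N) v).
  by case: (hT N).
have T0 N : T N 0 = 0 by rewrite -(linear0 (to_completion hp)) TE !linear0.
have Tnorm N x : `|T N x| = `|x| by rewrite -[T N x]subr0 -(T0 N) Tdist subr0.
have near_add (x : completion hp) a e : `|a| = 1 -> 0 < e ->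
    \forall N \near \oo, `|x + a *: T N x| <= `|x| + e.
  (* Four errors: replacing [x] by [u] in each of the two summands, comparing the norm of [u] with
     that of [x], and the estimate for the algebraic tensor [u]. *)
  move=> a1 e0; have e40 : 0 < e / 4 by rewrite divr_gt0.
  have [u /ltW xu] := to_completion_dense x e40.
  have := @projective_norm_add_shift R X a u (e / 4) _ e40.
  rewrite a1 => /(_ (lexx _)); apply: filterS => N.
  move=> /= le_u.
  have hN : `|to_completion hp u + a *: T N (to_completion hp u)| <=
      `|to_completion hp u| + e / 4.
    by rewrite TE -linearZ -linearD /= !to_completion_norm.
  have xE : x + a *: T N x = (x - to_completion hp u) +
      (a *: (T N x - T N (to_completion hp u))) +
      (to_completion hp u + a *: T N (to_completion hp u)).
    by rewrite [RHS]addrACA -scalerDr !subrK.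
  have ux : `|to_completion hp u| <= `|x| + e / 4.
    by rewrite -lerBlDl (le_trans (lerB_dist _ _))// distrC.
  rewrite xE (le_trans (ler_normD _ _))//.
  have := ler_normD (x - to_completion hp u)
    (a *: (T N x - T N (to_completion hp u))).
  rewrite normrZ a1 mul1r Tdist; lra.
have cvg_add (x : completion hp) a : `|a| = 1 -> `|x| = 1 ->
    `|x + a *: T N x| @[N --> \oo] --> (1 : R).
  move=> a1 x1; apply/cvgrPdist_le => e e0.
  have Na1 : `|- a| = 1 by rewrite normrN.
  have h1 := near_add x a e a1 e0; have h2 := near_add x (- a) e Na1 e0.
  apply: filterS2 h1 h2 => N; rewrite x1 => h1 h2.
  (* The upper estimate for [- a] thus gives the lower one for [a]. *)
  have : `|x *+ 2| <= `|x + a *: T N x| + `|x + - a *: T N x|.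
    rewrite (le_trans _ (ler_normD _ _))// addrACA -scalerDl subrr scale0r.
    by rewrite addr0 mulr2n.
  rewrite normrMn x1 => h3; rewrite ler_norml; apply/andP; split; lra.
move=> z z1; exists (fun N => T N z); split.
- by move=> N; rewrite Tnorm z1.
- by have := cvg_add z 1 (normr1 _) z1; under eq_fun do rewrite scale1r.
- by have := cvg_add z (-1) (normrN1 _) z1; under eq_fun do rewrite scaleN1r.
- by under eq_fun do rewrite Tnorm z1; exact: cvg_cst.
move=> f fc.
have [C C0 fC] : exists2 C : R, 0 < C & forall x, `|f x| <= C * `|x|.
  have /linear_boundedP/pinfty_ex_gt0[C C0 fC] :=
    continuous_linear_bounded 0 (fc 0).
  by exists C.
pose g := [the {linear tensor (c0 R) X -> R^o} of f \o to_completion hp].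
have gC u : `|g u| <= C * projective_norm u.
  by rewrite (le_trans (fC _))// to_completion_norm.
apply/cvgrPdist_le => e e0.
have e20 : 0 < e / 2 by rewrite divr_gt0.
(* As each [T N] preserves distances, replacing [z] by [u] changes [f (T N z)] by at most [e / 2],
   uniformly in [N]. *)
have [u /ltW zu] := to_completion_dense z (divr_gt0 e20 C0).
have /cvgrPdist_le/(_ _ e20) := bounded_tensor_shift_cvg0 gC u.
apply: filterS => N; rewrite !sub0r !normrN => hN.
rewrite -(subrK (T N (to_completion hp u)) (T N z)) linearD (splitr e).
rewrite (le_trans (ler_normD _ _))// lerD//; last by rewrite TE.
by rewrite (le_trans (fC _))// Tdist mulrC -ler_pdivlMr.
Qed.

Theorem proposition2p10 (R : realType) (X : completeNormedModType R)
  (X_neq0 : exists x : X, x != 0) :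
  LASQ (projective_tensor (c0 R) X) /\ D2P (projective_tensor (c0 R) X).
Proof.
have wasq := @projective_tensor_WASQ R X.
split; first exact: WASQ_LASQ.
by apply: WASQ_D2P => //; exact: projective_tensor_neq0.
Qed.
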